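(* Let $\bar x\in\mathbb{R}^n$ be a feasible point of the problem (MPCC). The following are equivalent. (a) $\bar x$ is linearized B-stationary. (b) $\bar x$ is $A_\alpha$-stationary for all $\alpha\in\{0,1\}^p$. (c) $\bar x$ is $P_d$-stationary for all $d\in[0,1]^p$. (d) $\bar x$ is $P_\alpha$-stationary for all $\alpha\in\{0,1\}^p$.
   Context: Let $f:\mathbb{R}^n\to\mathbb{R}$, $g:\mathbb{R}^n\to\mathbb{R}^l$, $h:\mathbb{R}^n\to\mathbb{R}^m$, $G,H:\mathbb{R}^n\to\mathbb{R}^p$ be differentiable functions. The mathematical program with complementarity constraints (MPCC) is: minimize $f(x)$ over $x\in\mathbb{R}^n$ subject to $g(x)\le 0$, $h(x)=0$, $G(x)\ge 0$, $H(x)\ge 0$, $G(x)^\top H(x)=0$ (inequalities componentwise). Index sets: $I^l=\{1,\dots,l\}$, $I^m=\{1,\dots,m\}$, $I^p=\{1,\dots,p\}$, $I^g(x)=\{i\in I^l: g_i(x)=0\}$, $I^{+0}(x)=\{i\in I^p: G_i(x)>0, H_i(x)=0\}$, $I^{0+}(x)=\{i\in I^p: G_i(x)=0, H_i(x)>0\}$, $I^{00}(x)=\{i\in I^p: G_i(x)=0, H_i(x)=0\}$, and for $\alpha\in\{0,1\}^p$ and $c\in\{0,1\}$, $I^{00}_{\alpha=c}(x)=\{i\in I^{00}(x): \alpha_i=c\}$. Weak stationarity: multipliers $\bar\lambda\in\mathbb{R}^l$, $\bar\eta\in\mathbb{R}^m$, $\bar\mu,\bar\nu\in\mathbb{R}^p$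 satisfy the system of weak stationarity at a feasible point $\bar x$ of (MPCC) if $$\nabla f(\bar x)+\sum_{i\in I^l}\bar\lambda_i\nabla g_i(\bar x)+\sum_{i\in I^m}\bar\eta_i\nabla h_i(\bar x)-\sum_{i\in I^p}\bar\mu_i\nabla G_i(\bar x)-\sum_{i\in I^p}\bar\nu_i\nabla H_i(\bar x)=0,$$ $\bar\lambda_i\ge 0$ for $i\in I^g(\bar x)$, $\bar\lambda_i=0$ for $i\in I^l\setminus I^g(\bar x)$, $\bar\mu_i=0$ for $i\in I^{+0}(\bar x)$, $\bar\nu_i=0$ for $i\in I^{0+}(\bar x)$. For $\alpha\in\{0,1\}^p$ and $d\in[0,1]^p$, a feasible point $\bar x$ is called - $A_\alpha$-stationary if there exist multipliers satisfying the system of weak stationarity together with $\bar\mu_i\ge 0$ for all $i\in I^{00}_{\alpha=0}(\bar x)$ and $\bar\nu_i\ge 0$ for all $i\in I^{00}_{\alpha=1}(\bar x)$; - $P_\alpha$-stationary if there exist multipliers satisfying the system of weak stationarity together with $(\bar\mu_i\ge 0\wedge\bar\nu_i\ge 0)\vee\bar\mu_i=0$ for all $i\in I^{00}_{\alpha=0}(\bar x)$ and $(\bar\mu_i\ge 0\wedge\bar\nu_i\ge 0)\vee\bar\nu_i=0$ for all $i\in I^{00}_{\alpha=1}(\bar x)$; - $P_d$-stationary if there exist multipliers satisfying the system of weak stationarity together with $(\bar\mu_i\ge 0\wedge\bar\nu_i\ge 0)\vee(1-d_i)\bar\mu_i=d_i\bar\nu_i$ for all $i\in I^{00}(\bar x)$;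 - linearized B-stationary if $-\nabla f(\bar x)\in\mathcal{T}_{\rm MPCC}^{\rm lin}(\bar x)^\circ$, where $C^\circ=\{d\in\mathbb{R}^n: d^\top y\le 0\ \forall y\in C\}$ is the polar cone of $C\subset\mathbb{R}^n$ and $\mathcal{T}_{\rm MPCC}^{\rm lin}(\bar x)$ is the set of all $d\in\mathbb{R}^n$ with $\nabla g_i(\bar x)^\top d\le 0$ for $i\in I^g(\bar x)$; $\nabla h_i(\bar x)^\top d=0$ for $i\in I^m$; $\nabla G_i(\bar x)^\top d=0$ for $i\in I^{0+}(\bar x)$; $\nabla H_i(\bar x)^\top d=0$ for $i\in I^{+0}(\bar x)$; and $\nabla G_i(\bar x)^\top d\ge 0$, $\nabla H_i(\bar x)^\top d\ge 0$, $(\nabla G_i(\bar x)^\top d)(\nabla H_i(\bar x)^\top d)=0$ for $i\in I^{00}(\bar x)$. *)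

(* Defs.v *)
From HB Require Import structures.
From mathcomp Require Import all_boot all_order all_algebra.
From mathcomp Require Import all_classical all_reals all_analysis.

Set Implicit Arguments.
Unset Strict Implicit.
Unset Printing Implicit Defensive.

Import Order.TTheory GRing.Theory Num.Theory.
Import numFieldNormedType.Exports.

Local Open Scope ring_scope.

(* R^n is represented by row vectors, and the i-th component of v is v 0 i. *)

Definition dot (R : realType) (n : nat) (u v : 'rV[R]_n) : R :=
  \sum_(i < n) u 0 i * v 0 i.

Definition grad (R : realType) (n : nat) (phi : 'rV[R]_n -> R) (x : 'rV[R]_n) :
    'rV[R]_n :=
  \row_(j < n) 'D_(delta_mx 0 j) phi x.

Definition polar (R : realType) (n : nat) (C : set 'rV[R]_n) : set 'rV[R]_n :=
  [set d | forall y, C y -> dot d y <= 0]%classic.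

(* minimize f(x) s.t. g(x) <= 0, h(x) = 0, G(x) >= 0, H(x) >= 0,
   G(x)^T H(x) = 0 *)
Record mpcc (R : realType) (n l m p : nat) := MPCC {
  mpcc_f : 'rV[R]_n -> R;
  mpcc_g : 'rV[R]_n -> 'rV[R]_l;
  mpcc_h : 'rV[R]_n -> 'rV[R]_m;
  mpcc_G : 'rV[R]_n -> 'rV[R]_p;
  mpcc_H : 'rV[R]_n -> 'rV[R]_p }.

Section MPCC.
Variables (R : realType) (n l m p : nat) (P : mpcc R n l m p).
Implicit Types x : 'rV[R]_n.

Local Notation f := (mpcc_f P).
Local Notation g := (mpcc_g P).
Local Notation h := (mpcc_h P).
Local Notation G := (mpcc_G P).
Local Notation H := (mpcc_H P).

Definition feasible x : Prop :=
  [/\ forall i, g x 0 i <= 0, h x = 0, forall i, 0 <= G x 0 i,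
      forall i, 0 <= H x 0 i & dot (G x) (H x) = 0].

Definition grad_f x : 'rV[R]_n := grad f x.
Definition grad_g (i : 'I_l) x : 'rV[R]_n := grad (fun y => g y 0 i) x.
Definition grad_h (i : 'I_m) x : 'rV[R]_n := grad (fun y => h y 0 i) x.
Definition grad_G (i : 'I_p) x : 'rV[R]_n := grad (fun y => G y 0 i) x.
Definition grad_H (i : 'I_p) x : 'rV[R]_n := grad (fun y => H y 0 i) x.

Definition I_g x : {set 'I_l} := [set i | g x 0 i == 0]%SET.
Definition I_p0 x : {set 'I_p} :=
  [set i | (0 < G x 0 i) && (H x 0 i == 0)]%SET.
Definition I_0p x : {set 'I_p} :=
  [set i | (G x 0 i == 0) && (0 < H x 0 i)]%SET.
Definition I_00 x : {set 'I_p} :=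
  [set i | (G x 0 i == 0) && (H x 0 i == 0)]%SET.

(* {0,1} is represented by bool, with false for 0 and true for 1. *)
Definition I_00eq (alpha : {ffun 'I_p -> bool}) (c : bool) x : {set 'I_p} :=
  [set i in I_00 x | alpha i == c]%SET.

Definition weak_stationarity x (lam : 'rV[R]_l) (eta : 'rV[R]_m)
    (mu nu : 'rV[R]_p) : Prop :=
  [/\ grad_f x + \sum_(i < l) lam 0 i *: grad_g i x
        + \sum_(i < m) eta 0 i *: grad_h i x
        - \sum_(i < p) mu 0 i *: grad_G i x
        - \sum_(i < p) nu 0 i *: grad_H i x = 0,
      forall i, i \in I_g x -> 0 <= lam 0 i,
      forall i, i \notin I_g x -> lam 0 i = 0,
      forall i, i \in I_p0 x -> mu 0 i = 0
    & forall i, i \in I_0p x -> nu 0 i = 0].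

Definition A_stationary (alpha : {ffun 'I_p -> bool}) x : Prop :=
  exists lam eta mu nu,
  [/\ weak_stationarity x lam eta mu nu,
      forall i, i \in I_00eq alpha false x -> 0 <= mu 0 i
    & forall i, i \in I_00eq alpha true x -> 0 <= nu 0 i].

Definition Palpha_stationary (alpha : {ffun 'I_p -> bool}) x : Prop :=
  exists lam eta mu nu,
  [/\ weak_stationarity x lam eta mu nu,
      forall i, i \in I_00eq alpha false x ->
        (0 <= mu 0 i /\ 0 <= nu 0 i) \/ mu 0 i = 0
    & forall i, i \in I_00eq alpha true x ->
        (0 <= mu 0 i /\ 0 <= nu 0 i) \/ nu 0 i = 0].

Definition Pd_stationary (d : 'rV[R]_p) x : Prop :=
  exists lam eta mu nu,
    weak_stationarity x lam eta mu nu /\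
    forall i, i \in I_00 x ->
      (0 <= mu 0 i /\ 0 <= nu 0 i) \/
      (1 - d 0 i) * mu 0 i = d 0 i * nu 0 i.

Definition lin_tangent_cone x : set 'rV[R]_n :=
  [set d | [/\ forall i, i \in I_g x -> dot (grad_g i x) d <= 0,
               forall i, dot (grad_h i x) d = 0,
               forall i, i \in I_0p x -> dot (grad_G i x) d = 0,
               forall i, i \in I_p0 x -> dot (grad_H i x) d = 0
             & forall i, i \in I_00 x ->
                 [/\ 0 <= dot (grad_G i x) d, 0 <= dot (grad_H i x) d
                   & dot (grad_G i x) d * dot (grad_H i x) d = 0]]]%classic.

Definition lin_B_stationary x : Prop :=
  polar (lin_tangent_cone x) (- grad_f x).

End MPCC.

(* Main.v *)
(* Every implication except "A_alpha for all alpha implies P_d" is linear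
   algebra. Fixing alpha replaces the nonconvex linearized cone by a polyhedral
   subcone, to which Farkas' lemma applies and yields A_alpha-multipliers. The
   choice d = alpha turns P_d into P_alpha. A direction y of the linearized cone
   is handled by the P_alpha-multipliers, with alpha_i = 1 exactly when
   dG_i y = 0, since then every term mu_i dG_i y + nu_i dH_i y is nonnegative.

   For the remaining implication, interpolate the multipliers given at the
   vertices alpha of [0,1]^p multilinearly; the set of weak multipliers being
   convex, every t in the cube yields weak multipliers mu(t), nu(t). On the face
   t_i = 0 we have mu_i >= 0, and on t_i = 1 we have nu_i >= 0. The closed sets
   {mu >= 0 or (1-d)mu >= d nu} and {nu >= 0 or (1-d)mu <= d nu} cover the plane
   and meet exactly in the quadrant united with the line (1-d)mu = d nu, so the
   Poincare-Miranda theorem provides the required t.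

   The Poincare-Miranda theorem follows by compactness from a combinatorial
   statement on the grid {0,...,N}^p, proved by a discrete mod 2 degree: with
   s_i the indicator of the i-th label, the sum over all monotone lattice paths
   z = v_0, ..., v_p inside the unit cubes of prod_i (s_i(v_i) - s_i(v_(i-1)))
   is the sum of a divergence, hence depends only on the boundary values of the
   labels and equals 1. *)
Require Import Defs.
From mathcomp Require Import all_boot all_order all_algebra.
From mathcomp Require Import all_classical all_reals all_analysis.
From mathcomp Require Import ring lra.
Import Order.TTheory GRing.Theory Num.Theory.
Import numFieldNormedType.Exports.
Local Open Scope ring_scope.

Set Implicit Arguments.
Unset Strict Implicit.
Unset Printing Implicit Defensive.

(** * Sign changes on a grid *)

Lemma addF2 (x : 'F_2) : x + x = 0.
Proof. by apply: addrr_pchar2; apply: pchar_Fp. Qed.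

Lemma sum_diff_F2 N (x : nat -> 'F_2) :
  \sum_(a < N) (x a.+1 + x a) = x N + x 0%N.
Proof.
elim: N => [|N IHN]; first by rewrite big_ord0 addF2.
by rewrite big_ord_recr /= IHN addrC -addrA (addrA (x N)) addF2 add0r.
Qed.

(** Every unordered pair of distinct indices is counted twice, so the terms cancel mod 2. Comparing
    ranks splits the ordered pairs into two halves that symmetry exchanges. *)
Lemma sum_sym_F2 (I : finType) (J : {set I}) (F : I -> I -> 'F_2) :
    (forall i j, F i j = F j i) ->
  \sum_(i in J) \sum_(j in J :\ i) F i j = 0.
Proof.
move=> Fsym.
pose S (lt : rel nat) := \sum_(i in J)
  \sum_(j | (j \in J) && lt (enum_rank i) (enum_rank j)) F i j.
have SC : S ltn = S gtn.
  rewrite /S (exchange_big_dep (mem J)) /=; last by move=> i j _ /andP[].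
  apply: eq_bigr => i iJ; apply: eq_big => [j|j _]; last exact: Fsym.
  by rewrite iJ.
transitivity (S ltn + S gtn); last by rewrite SC addF2.
rewrite /S -big_split /=; apply: eq_bigr => i iJ.
rewrite (bigID (fun j => (enum_rank i < enum_rank j)%N)) /=.
congr (_ + _); apply: eq_bigl => j; rewrite in_setD1.
  by case: (eqVneq j i) => //= ->; rewrite ltnn andbF.
rewrite -leqNgt leq_eqVlt.
have -> : (enum_rank j == enum_rank i :> nat) = (j == i).
  by rewrite (inj_eq val_inj) (inj_eq enum_rank_inj).
by case: (eqVneq j i) => //= ->; rewrite ltnn andbF.
Qed.

Section Grid.
Variable p : nat.
Local Notation pt := {ffun 'I_p -> nat}.
Implicit Types (z u v : pt) (i j : 'I_p) (J : {set 'I_p}).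
Implicit Types (f : pt -> 'F_2) (r : seq 'I_p).
Variable s : 'I_p -> pt -> 'F_2.

Definition shift j z : pt := [ffun i => (z i + (i == j))%N].
Definition upd z j a : pt := [ffun i => if i == j then a else z i].

(* The sum of prod_k (s_(r_k)(v_(k+1)) - s_(r_k)(v_k)) over the lattice paths
   v_0 = z, v_1, ... whose steps are distinct unit vectors with index in J. *)
Fixpoint path_sum r J z : 'F_2 :=
  if r is k :: r' then
    \sum_(j in J) (s k (shift j z) + s k z) * path_sum r' (J :\ j) (shift j z)
  else 1.

Fixpoint grid_sum N r f z : 'F_2 :=
  if r is j :: r' then \sum_(a < N) grid_sum N r' f (upd z j a) else f z.

Lemma shiftC i j z : shift i (shift j z) = shift j (shift i z).
Proof. by apply/ffunP => k; rewrite !ffunE addnAC. Qed.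

Lemma shift_upd i j z a : i != j -> shift j (upd z i a) = upd (shift j z) i a.
Proof.
move=> ij; apply/ffunP => k; rewrite !ffunE.
by case: (eqVneq k i) => // ->; rewrite (negbTE ij) addn0.
Qed.

Lemma shift_upd_same j z a : shift j (upd z j a) = upd z j a.+1.
Proof.
apply/ffunP => k; rewrite !ffunE; case: eqP => _; first by rewrite addn1.
by rewrite addn0.
Qed.

(* The discrete counterpart of the identity d(ds_1 /\ ... /\ ds_q) = 0. *)
Lemma path_sum_closed r J z :
  \sum_(j in J) (path_sum r (J :\ j) (shift j z) + path_sum r (J :\ j) z) = 0.
Proof.
elim: r J z => [|k r IHr] J z /=.
  by apply: big1 => j _; rewrite addF2.
(* [F] multiplies the mixed second difference of [s k] by the tail of the path at the far corner. It
   is symmetric in [i] and [j], hence sums to zero; what remains is, for each [j], the induction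
   hypothesis for [J :\ j] at [shift j z]. *)
pose F i j :=
  (s k (shift i (shift j z)) + s k (shift i z) + s k (shift j z) + s k z)
   * path_sum r (J :\ i :\ j) (shift i (shift j z)).
transitivity (\sum_(j in J) \sum_(i in J :\ j) F j i +
   \sum_(j in J) (s k (shift j z) + s k z) *
     \sum_(i in J :\ j) (path_sum r (J :\ j :\ i) (shift i (shift j z))
                        + path_sum r (J :\ j :\ i) (shift j z))).
  transitivity (\sum_(j in J) \sum_(i in J :\ j) (F j i +
       (s k (shift i z) + s k z) *
         (path_sum r (J :\ j :\ i) (shift j (shift i z))
          + path_sum r (J :\ j :\ i) (shift i z)))).
    apply: eq_bigr => j jJ; rewrite -big_split /=; apply: eq_bigr => i iJ.
    rewrite /F (shiftC j i).
    move: (s k (shift i _)) (s k (shift j z)) (s k (shift i z)) (s k z).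
    move: (path_sum _ _ _) (path_sum _ _ _) => Y X A B C D.
    have -> : (A + B + C + D) * X + (C + D) * (X + Y) =
      (A + B) * X + (C + D) * Y + ((C + D) * X + (C + D) * X) by ring.
    by rewrite addF2 addr0.
  under eq_bigr => j _ do rewrite big_split.
  rewrite big_split /=; congr (_ + _).
  rewrite (exchange_big_dep (mem J)) /=; last by move=> i j _ /setD1P[].
  apply: eq_bigr => j jJ; rewrite mulr_sumr; apply: eq_big => i.
    by rewrite !in_setD1 jJ andbT andbC eq_sym.
  by move=> _; rewrite !finset.setDDl (finset.setUC [set i]).
rewrite sum_sym_F2 ?add0r; last first.
  move=> i j; rewrite /F (shiftC i j) !finset.setDDl (finset.setUC [set i]).
  by rewrite (addrAC (s _ _)).
by apply: big1 => j _; rewrite IHr mulr0.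
Qed.

(** Adding [s k z] times the vanishing sum of [path_sum_closed] turns the path sum into a
    divergence: the term for [j] is the difference in direction [j] of [s k] times
    [path_sum r (J :\ j)]. *)
Lemma path_sum_cons k r J z :
  path_sum (k :: r) J z =
  \sum_(j in J) (s k (shift j z) * path_sum r (J :\ j) (shift j z)
                 + s k z * path_sum r (J :\ j) z).
Proof.
transitivity (path_sum (k :: r) J z + s k z * \sum_(j in J)
  (path_sum r (J :\ j) (shift j z) + path_sum r (J :\ j) z)).
  by rewrite path_sum_closed mulr0 addr0.
rewrite /= mulr_sumr -big_split /=; apply: eq_bigr => j _.
move: (path_sum _ _ _) (path_sum _ _ _) (s _ _) (s _ _) => Y X b a.
have -> : (a + b) * X + b * (X + Y) = a * X + b * Y + (b * X + b * X) by ring.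
by rewrite addF2 addr0.
Qed.

(** Paths with steps in [J] never move in direction [j], so they stay in a slice on which [s k] is
    constant, and the factor for [k] vanishes. *)
Lemma path_sum_eq0 r J j k u : j \notin J -> k \in r ->
    (forall v w : pt, v j = u j -> w j = u j -> s k v = s k w) ->
  path_sum r J u = 0.
Proof.
elim: r J u => [//|k' r IHr] J u jJ; rewrite inE => kr sE /=.
apply: big1 => i iJ; have ij : i != j by apply: contraNneq jJ => <-.
have shj : shift i u j = u j by rewrite ffunE eq_sym (negbTE ij) addn0.
have [kk'|kk'] := eqVneq k k'.
  by rewrite -kk' (sE (shift i u) u) // addF2 mul0r.
rewrite IHr ?mulr0 //; first by rewrite in_setD1 (negbTE jJ) andbF.
  by move: kr; rewrite (negbTE kk').
by move=> v w vj wj; apply: sE; rewrite ?vj ?wj.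
Qed.

(** Some path contributes a nonzero product, so every label in [r] changes along one of its steps,
    and both ends of that step lie in the cell at [z]. *)
Lemma path_sum_neq0 r J z k : path_sum r J z != 0 -> k \in r ->
  exists u v, [/\ s k u != s k v,
    forall i, (z i <= u i <= z i + (i \in J))%N &
    forall i, (z i <= v i <= z i + (i \in J))%N].
Proof.
elim: r J z => [//|k' r IHr] J z /= W; rewrite inE => kr.
have [j jJ] : exists2 j, j \in J &
    (s k' (shift j z) + s k' z) * path_sum r (J :\ j) (shift j z) != 0.
  apply/exists_inP; apply: contraR W => /exists_inPn W.
  by apply/eqP; apply: big1 => j jJ; apply/eqP; move/negPn: (W j jJ).
rewrite mulf_eq0 negb_or => /andP[s'j Wj].
have zJ i : (z i + (i == j) <= z i + (i \in J))%N.
  by rewrite leq_add2l; case: eqP => [->|//]; rewrite jJ.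
case/predU1P: kr => [->|kr].
  exists (shift j z), z; split=> [|i|i].
  - by apply: contraNneq s'j => ->; rewrite addF2.
  - by rewrite ffunE leq_addr zJ.
  - by rewrite leqnn leq_addr.
have [u [v [suv uz vz]]] := IHr _ _ Wj kr.
have up i (w : pt) :
    (shift j z i <= w i <= shift j z i + (i \in J :\ j))%N ->
    (z i <= w i <= z i + (i \in J))%N.
  rewrite ffunE in_setD1 => /andP[lo hi].
  rewrite (leq_trans _ lo) ?leq_addr //=.
  by apply: leq_trans hi _; case: eqP => [->|_]; rewrite ?jJ ?addn0.
by exists u, v; split=> // i; apply: up.
Qed.

Lemma eq_grid_sum N r f f' z :
  (forall u, (forall i, i \notin r -> u i = z i) -> f u = f' u) ->
  grid_sum N r f z = grid_sum N r f' z.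
Proof.
elim: r z => [|j r IHr] z ff' /=; first exact: ff'.
apply: eq_bigr => a _; apply: IHr => u uz; apply: ff' => i.
by rewrite inE negb_or => /andP[ij /uz]; rewrite ffunE (negbTE ij).
Qed.

Lemma grid_sum_sum N r (I : finType) (K : {set I}) (F : I -> pt -> 'F_2) z :
  grid_sum N r (fun u => \sum_(k in K) F k u) z =
  \sum_(k in K) grid_sum N r (F k) z.
Proof.
elim: r z => [//|j r IHr] z /=.
by rewrite exchange_big; apply: eq_bigr => a _.
Qed.

Lemma grid_sum_diff N r f j z : j \notin r ->
  grid_sum N r (fun u => f (shift j u) + f u) z =
  grid_sum N r f (shift j z) + grid_sum N r f z.
Proof.
elim: r z => [//|i r IHr] z /=; rewrite inE negb_or => /andP[ji jr].
rewrite -big_split; apply: eq_bigr => a _.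
by rewrite IHr // shift_upd // eq_sym.
Qed.

(** Telescoping in direction [j] leaves the two opposite faces, with a plus sign since signs are
    irrelevant mod 2. *)
Lemma grid_sum_diff_cons N r f j z : j \notin r ->
  grid_sum N (j :: r) (fun u => f (shift j u) + f u) z =
  grid_sum N r f (upd z j N) + grid_sum N r f (upd z j 0).
Proof.
move=> jr /=; rewrite -(sum_diff_F2 N (fun a => grid_sum N r f (upd z j a))).
by apply: eq_bigr => a _; rewrite grid_sum_diff // shift_upd_same.
Qed.

Lemma grid_sum_eq0 N r f z :
  (forall u, (forall i, i \notin r -> u i = z i) -> f u = 0) ->
  grid_sum N r f z = 0.
Proof.
move=> f0; rewrite (@eq_grid_sum _ _ _ (fun=> 0)) // {f0}.
by elim: r z => [//|j r IHr] z /=; rewrite big1.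
Qed.

Lemma grid_sum_diff_eq0 N r f j z : uniq r -> j \in r ->
    (forall u, u j = 0%N \/ u j = N -> f u = 0) ->
  grid_sum N r (fun u => f (shift j u) + f u) z = 0.
Proof.
elim: r z => [//|i r IHr] z /andP[ir ur]; rewrite inE => jr f0.
case/predU1P: jr => [ji|jr]; last by apply: big1 => a _; apply: IHr.
rewrite -{i}ji in ir *.
rewrite grid_sum_diff_cons // !grid_sum_eq0 ?addF2 // => u /(_ _ ir).
  by rewrite ffunE eqxx => uj; apply: f0; left.
by rewrite ffunE eqxx => uj; apply: f0; right.
Qed.

Lemma grid_sum_neq0 N r f z0 : grid_sum N r f z0 != 0 ->
  exists2 z, f z != 0 & forall i, (i \in r -> z i < N)%N /\
                                  (i \notin r -> z i = z0 i).
Proof.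
elim: r z0 => [|j r IHr] z0 /=; first by exists z0.
move=> W; have [a /IHr[z fz zr]] : exists a : 'I_N,
    grid_sum N r f (upd z0 j a) != 0.
  apply/existsP; apply: contraR W => /existsPn W.
  by apply/eqP; apply: big1 => a _; apply/eqP; move/negPn: (W a).
exists z => // i; rewrite inE; have [zlt zE] := zr i.
have [/zlt iN|ir] := boolP (i \in r); first by rewrite orbT iN.
by rewrite orbF zE // ffunE; case: eqP => // _; split.
Qed.

(** Induction on the directions, by the divergence form. In direction [j] the face at [N] drops out
    because [s j] is 0 there, and the face at 0, where [s j] is 1, carries the same sum for the
    remaining directions. *)
Lemma grid_path_sum N r z :
    uniq r ->
    (forall i u, u i = 0%N -> s i u = 1) ->
    (forall i u, u i = N -> s i u = 0) ->
  grid_sum N r (path_sum r [set i in r]) z = 1.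
Proof.
move=> + s0 sN; elim: r z => [//|j r IHr] z /andP[jr ur].
set J := [set i in j :: r]; pose f i u := s j u * path_sum r (J :\ i) u.
rewrite (@eq_grid_sum _ _ _ (fun u => \sum_(i in J) (f i (shift i u) + f i u)));
  last by move=> u _; rewrite path_sum_cons.
rewrite grid_sum_sum (bigD1 j) ?inE ?eqxx //=.
rewrite [X in X + _](grid_sum_diff_cons N (f j) z jr).
rewrite [X in X + _ + _]grid_sum_eq0 ?add0r; last first.
  by move=> u /(_ _ jr) uj; rewrite /f sN ?mul0r // uj ffunE eqxx.
rewrite (@eq_grid_sum _ _ _ (path_sum r [set i in r])).
  (* A direction [i] other than [j] contributes nothing: on both of its faces the label [i] is
     constant, and paths in [J :\ i] do not leave the face. *)
  rewrite IHr // big1 ?addr0 // => i /andP[]; rewrite !inE => iJ ij.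
  apply: (@grid_sum_diff_eq0 N (j :: r) (f i) i z) => /=; first by rewrite jr.
    by rewrite inE.
  move=> u ui; rewrite /f (@path_sum_eq0 _ _ i i) ?mulr0 ?in_setD1 ?eqxx //.
    by move: iJ; rewrite (negbTE ij).
  by move=> v w vi wi; case: ui => ui; [rewrite !s0 | rewrite !sN];
    rewrite ?vi ?wi.
move=> u /(_ _ jr) uj; rewrite /f s0 ?mul1r; last by rewrite uj ffunE eqxx.
congr path_sum; apply/setP => i; rewrite !inE.
by case: eqP => // ->; rewrite (negbTE jr).
Qed.
End Grid.

(** The path sums over all cells add up to 1 in ['F_2], so some cell has a nonzero one, and there
    every label takes both values. *)
Lemma cube_sign_change p N (L : 'I_p -> {ffun 'I_p -> nat} -> bool) :
    (forall i (u : {ffun 'I_p -> nat}), u i = 0%N -> L i u) ->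
    (forall i (u : {ffun 'I_p -> nat}), u i = N -> ~~ L i u) ->
  exists2 z : {ffun 'I_p -> nat}, forall i, (z i < N)%N &
  forall i, exists u v : {ffun 'I_p -> nat}, [/\ L i u, ~~ L i v,
    forall j, (z j <= u j <= z j + 1)%N & forall j, (z j <= v j <= z j + 1)%N].
Proof.
move=> L0 LN; pose s i u : 'F_2 := (L i u)%:R.
have s0 i (u : {ffun 'I_p -> nat}) : u i = 0%N -> s i u = 1.
  by move=> ui; rewrite /s L0.
have sN i (u : {ffun 'I_p -> nat}) : u i = N -> s i u = 0.
  by move=> ui; rewrite /s (negbTE (LN _ _ ui)).
have W := grid_path_sum [ffun=> 0%N] (enum_uniq 'I_p) s0 sN.
have := oner_neq0 'F_2; rewrite -[X in X != _]W => /grid_sum_neq0[z Wz zN].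
exists z => [i|i]; first by case: (zN i); rewrite mem_enum => ->.
have [u [v [suv uz vz]]] := path_sum_neq0 Wz (mem_enum 'I_p i).
have le1 (w : {ffun 'I_p -> nat}) :
    (forall j, z j <= w j <= z j + (j \in [set k in enum 'I_p]))%N ->
    forall j, (z j <= w j <= z j + 1)%N.
  by move=> wz j; have:= wz j; rewrite inE mem_enum.
case Lu: (L i u); case Lv: (L i v); move: suv; rewrite /s Lu Lv ?eqxx // => _.
  by exists u, v; rewrite Lu Lv; split=> //; apply: le1.
by exists v, u; rewrite Lu Lv; split=> //; apply: le1.
Qed.

(** * The Poincare-Miranda theorem *)

Section PoincareMiranda.
Local Open Scope classical_set_scope.
Local Open Scope ring_scope.

(** Passes from approximate to exact membership: the points [t N] need not lie in [A], only have
    points of [A] ever closer to them. *)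
Lemma closure_cluster_near (R : realType) (V : pseudoMetricType R)
    (A : set V) (t : nat -> V) (t0 : V) :
    closed A -> cluster (t @ \oo) t0 ->
    (forall e, 0 < e -> \forall N \near \oo, exists2 u, A u & ball (t N) e u) ->
  A t0.
Proof.
move=> clA ct tA; apply: clA => U /nbhs_ballP[e /= e0 eU].
have e20 : 0 < e / 2 by rewrite divr_gt0.
have [s [[u Au su] st]] := ct [set s | exists2 u, A u & ball s (e / 2) u]
  _ (tA _ e20) (nbhsx_ballx t0 _ e20).
exists u; split => //; apply: eU; rewrite [e]splitr.
exact: ball_triangle st su.
Qed.

Definition in_cube (R : realType) p (t : 'rV[R]_p) := forall i, 0 <= t 0 i <= 1.

Lemma compact_cube (R : realType) p : compact [set t : 'rV[R]_p | in_cube t].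
Proof.
have := @rV_compact R p (fun=> `[0, 1]%classic) (fun=> @segment_compact R 0 1).
by congr compact; apply/funext => t /=; apply/propext; split => H i;
  have := H i; rewrite in_itv.
Qed.

Theorem poincare_miranda (R : realType) p (A B : 'I_p -> set 'rV[R]_p) :
    (forall i, closed (A i)) -> (forall i, closed (B i)) ->
    (forall i t, in_cube t -> t 0 i = 0 -> A i t) ->
    (forall i t, in_cube t -> t 0 i = 1 -> B i t) ->
    (forall i t, in_cube t -> A i t \/ B i t) ->
  exists2 t, in_cube t & forall i, A i t /\ B i t.
Proof.
move=> clA clB A0 B1 AB.
pose grid N (u : {ffun 'I_p -> nat}) : 'rV[R]_p :=
  \row_i ((u i)%:R / N.+1%:R).
have grid_cube N (u : {ffun 'I_p -> nat}) :
    (forall j, (u j <= N.+1)%N) -> in_cube (grid N u).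
  move=> uN i; rewrite mxE divr_ge0 ?ler0n //= ler_pdivrMr ?ltr0n // mul1r.
  by rewrite ler_nat.
have step N : exists t, in_cube t /\ forall i,
    (exists2 u, A i u & ball t (2 / N.+1%:R) u) /\
    (exists2 u, B i u & ball t (2 / N.+1%:R) u).
  (* The boundary labels are imposed by force and the others record membership in [A i]. A true
     label still implies [A i], by the hypothesis on the face 0; a false one implies [B i], by the
     hypothesis on the face 1 or by the covering. *)
  pose L i (u : {ffun 'I_p -> nat}) :=
    (u i == 0%N) || ((u i != N.+1) && `[<A i (grid N u)>]).
  have L0 i (u : {ffun 'I_p -> nat}) : u i = 0%N -> L i u by rewrite /L => ->.
  have LN i (u : {ffun 'I_p -> nat}) : u i = N.+1 -> ~~ L i u.
    by rewrite /L => ->; rewrite eqxx.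
  have [z zN Lz] := cube_sign_change L0 LN.
  (* Coordinates within a cell differ by at most one mesh width; the factor 2 provides the strict
     inequality of an open ball. *)
  have near_z (u : {ffun 'I_p -> nat}) :
      (forall j, (z j <= u j <= z j + 1)%N) ->
      in_cube (grid N u) /\ ball (grid N z) (2 / N.+1%:R) (grid N u).
    move=> zu; split.
      apply: grid_cube => j; have /andP[_ /leq_trans] := zu j; apply.
      by rewrite addn1; apply: zN.
    split=> [|k j]; first by rewrite divr_gt0 ?ltr0n.
    rewrite /ball /= !mxE -mulrBl normrM [`|_^-1|]ger0_norm ?invr_ge0 //.
    rewrite ltr_pM2r ?invr_gt0 ?ltr0n //.
    have /andP[zu1 zu2] := zu j.
    rewrite -(subnKC zu1) natrD opprD addNKr normrN ger0_norm ?ler0n //.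
    by rewrite ltr_nat ltnS leq_subLR.
  exists (grid N z); split=> [|i]; first by apply: grid_cube => j; apply: ltnW.
  have [u [v [Lu Lv /near_z[cu zu] /near_z[cv zv]]]] := Lz i.
  split; [exists (grid N u) => // | exists (grid N v) => //].
    case/orP: Lu => [/eqP u0|/andP[_ /asboolP//]].
    by apply: A0; rewrite // mxE u0 mul0r.
  move: Lv; rewrite /L negb_or negb_and negbK.
  move=> /andP[_ /orP[/eqP vN|/asboolP nA]].
    by apply: B1; rewrite // mxE vN divff ?pnatr_eq0.
  by case: (AB i _ cv).
have [t tP] := choice step.
have [t0 [ct0 clt0]] : exists t0, in_cube t0 /\ cluster (t @ \oo) t0.
  have [|t0 [? ?]] := @compact_cube R p (t @ \oo) (fmap_proper_filter t _).
    by exists 0%N => // N _; exact: (tP N).1.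
  by exists t0.
have small (e : R) : 0 < e -> \forall N \near \oo, 2 / N.+1%:R <= e.
  move=> e0; have e20 : 0 < e / 2 by rewrite divr_gt0.
  have := near_infty_natSinv_lt (PosNum e20); apply: filterS => N /= He.
  by rewrite mulrC -ler_pdivlMr // ltW.
exists t0 => // i; split.
  apply: closure_cluster_near (clA i) clt0 _ => e /small.
  apply: filterS => N Ne; have [[u Au tu] _] := (tP N).2 i.
  by exists u => //; apply: le_ball tu.
apply: closure_cluster_near (clB i) clt0 _ => e /small.
apply: filterS => N Ne; have [_ [u Bu tu]] := (tP N).2 i.
by exists u => //; apply: le_ball tu.
Qed.
End PoincareMiranda.

(** * Farkas' lemma *)

Section Dot.
Variables (R : realType) (n : nat).
Implicit Types (u v y : 'rV[R]_n) (k : R).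

Lemma dotC u v : dot u v = dot v u.
Proof. by apply: eq_bigr => i _; rewrite mulrC. Qed.

Lemma dotDl u v y : dot (u + v) y = dot u y + dot v y.
Proof.
by rewrite -big_split /=; apply: eq_bigr => i _; rewrite !mxE mulrDl.
Qed.

Lemma dotZl k u y : dot (k *: u) y = k * dot u y.
Proof. by rewrite /dot mulr_sumr; apply: eq_bigr => i _; rewrite mxE mulrA. Qed.

Lemma dotNl u y : dot (- u) y = - dot u y.
Proof. by rewrite -scaleN1r dotZl mulN1r. Qed.

Lemma dot0l y : dot 0 y = 0.
Proof. by rewrite -(scale0r 0) dotZl mul0r. Qed.

Lemma dot_lincombl (I : finType) (c : I -> R) (a : I -> 'rV[R]_n) y :
  dot (\sum_i c i *: a i) y = \sum_i c i * dot (a i) y.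
Proof.
rewrite (big_morph (fun u => dot u y) (fun u v => dotDl u v y) (dot0l y)).
by apply: eq_bigr => i _; apply: dotZl.
Qed.

Lemma dot_eq0 u : dot u u <= 0 -> u = 0.
Proof.
move=> u0; apply/rowP => i; rewrite mxE.
have pos j : 0 <= u 0 j * u 0 j by rewrite -expr2 sqr_ge0.
have /psumr_eq0P : \sum_j u 0 j * u 0 j = 0.
  by apply/eqP; rewrite eq_le u0 sumr_ge0.
by move=> /(_ (fun j _ => pos j) i isT) /eqP; rewrite mulf_eq0 orbb => /eqP.
Qed.
End Dot.

Lemma farkas_ord (R : realType) (n k : nat) (a : 'I_k -> 'rV[R]_n) b :
    (forall y, (forall i, dot (a i) y <= 0) -> dot b y <= 0) ->
  exists2 c : 'I_k -> R, forall i, 0 <= c i & b = \sum_i c i *: a i.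
Proof.
elim: k a b => [|k IHk] a b H.
  exists (fun=> 0) => //; rewrite big_ord0; apply: dot_eq0.
  by apply: H => -[].
have [Q|] := pselect (forall y, (forall i, dot (a (lift ord0 i)) y <= 0) ->
                       dot b y <= 0).
  have [c c0 bE] := IHk _ _ Q.
  exists (fun i => oapp c 0 (unlift ord0 i)) => [i|].
    by case: unlift => /=.
  rewrite big_ord_recl unlift_none /= scale0r add0r bE.
  by apply: eq_bigr => i _; rewrite liftK.
case/existsNP => u /not_implyP[au /negP]; rewrite -ltNge => bu.
have a0u : 0 < dot (a ord0) u.
  rewrite ltNge; apply/negP => a0u; move: bu; rewrite ltNge => /negP; apply.
  by apply: H => i; case: (unliftP ord0 i) => [j ->|->].
set d := dot (a ord0) u in a0u.
(* [proj] projects along [a ord0] onto the orthogonal complement of [u]. Its adjoint sends [y] to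
   the vector [y'] below, which is orthogonal to [a ord0], so the hypothesis applies to [y']. *)
pose proj v := v - (dot v u / d) *: a ord0.
have [|c c0 bE] := IHk (fun i => proj (a (lift ord0 i))) (proj b).
  move=> y Hy.
  pose y' := y - (dot (a ord0) y / d) *: u.
  have projE v : dot (proj v) y = dot v y'.
    rewrite /proj /y' dotDl dotNl dotZl [RHS]dotC dotDl dotNl dotZl.
    by rewrite ![dot _ v]dotC; ring.
  rewrite projE; apply: H => i; case: (unliftP ord0 i) => [j ->|->].
    by rewrite -projE.
  rewrite -projE /proj dotDl dotNl dotZl divff ?mul1r ?subrr //.
  by rewrite gt_eqF.
(* Undoing the projections in [proj b] collects this coefficient of [a ord0]. It is nonnegative
   because [b] has a positive product with [u] and the other vectors have nonpositive ones. *)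
exists (fun i => if unlift ord0 i is Some j then c j else
   dot b u / d - \sum_j c j * (dot (a (lift ord0 j)) u / d)) => [i|].
  case: unlift => //; rewrite subr_ge0.
  apply: le_trans (divr_ge0 (ltW bu) (ltW a0u)); apply: sumr_le0 => j _.
  rewrite mulr_ge0_le0 // mulr_le0_ge0 // invr_ge0.
  exact: ltW.
rewrite big_ord_recl unlift_none.
rewrite [X in _ = _ + X](eq_bigr (fun i => c i *: a (lift ord0 i))); last first.
  by move=> i _; rewrite liftK.
transitivity ((dot b u / d) *: a ord0 + proj b).
  by rewrite /proj addrC subrK.
rewrite {}bE scalerBl -addrA; congr (_ + _).
rewrite scaler_suml addrC -sumrB; apply: eq_bigr => i _.
by rewrite /proj scalerBr scalerA.
Qed.

Theorem farkas (R : realType) (n : nat) (T : finType) (E : {set T})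
    (a : T -> 'rV[R]_n) b :
    (forall y, (forall i, i \notin E -> dot (a i) y <= 0) ->
               (forall i, i \in E -> dot (a i) y = 0) -> dot b y <= 0) ->
  exists2 c : T -> R, forall i, i \notin E -> 0 <= c i & b = \sum_i c i *: a i.
Proof.
move=> H.
(* An equation is split into two opposite inequalities; for an index outside [E] the second copy is
   padded with the zero vector. *)
pose a' (j : T * bool) : 'rV[R]_n :=
  if j.2 then a j.1 else if j.1 \in E then - a j.1 else 0.
have [y Hy|c c0 bE] := @farkas_ord R n #|{: T * bool}|
    (fun k => a' (enum_val k)) b.
  have {}Hy j : dot (a' j) y <= 0 by rewrite -(enum_rankK j); apply: Hy.
  apply: H => i iE; first exact: (Hy (i, true)).
  apply/eqP; rewrite eq_le (Hy (i, true)) -oppr_le0 -dotNl.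
  by have := Hy (i, false); rewrite /a' /= iE.
pose c' j := c (enum_rank j).
exists (fun i => c' (i, true) - (if i \in E then c' (i, false) else 0)).
  by move=> i /negbTE ->; rewrite subr0; apply: c0.
transitivity (\sum_j c' j *: a' j).
  rewrite bE [RHS]big_enum_val; apply: eq_bigr => k _.
  by rewrite /c' enum_valK.
rewrite (eq_bigr (fun j => c' (j.1, j.2) *: a' (j.1, j.2))); last by case.
rewrite -(pair_bigA _ (fun i x => c' (i, x) *: a' (i, x))) /=.
apply: eq_bigr => i _; rewrite big_bool /a' /=.
by case: ifP => _; rewrite ?scaler0 ?subr0 ?addr0 // scalerN scalerBl.
Qed.

(** * Interpolation of multipliers *)

Section Interpolation.
Local Open Scope classical_set_scope.
Local Open Scope ring_scope.
Variables (R : realType) (p : nat).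
Local Notation vertex := {ffun 'I_p -> bool}.
Implicit Types (t d : 'rV[R]_p) (alpha : vertex) (k : vertex -> R).

(** The multilinear interpolation basis on the cube; equivalently, the probability of [alpha] when
    its coordinates are independent Bernoulli variables with parameters [t 0 i]. *)
Definition weight t alpha : R :=
  \prod_i (if alpha i then t 0 i else 1 - t 0 i).

Definition interp k t : R := \sum_alpha weight t alpha * k alpha.

Lemma weight_ge0 t alpha : in_cube t -> 0 <= weight t alpha.
Proof.
by move=> ct; apply: prodr_ge0 => i _; have /andP[? ?] := ct i; case: ifP; lra.
Qed.

Lemma sum_weight t : \sum_alpha weight t alpha = 1.
Proof.
rewrite /weight.
rewrite -(bigA_distr_bigA (fun i (b : bool) => if b then t 0 i else 1 - t 0 i)).
by apply: big1 => i _; rewrite big_bool /= addrC subrK.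
Qed.

Lemma weight_eq0 t alpha i : t 0 i = (~~ alpha i)%:R -> weight t alpha = 0.
Proof.
move=> ti; rewrite /weight (bigD1 i) //= ti.
by case: (alpha i); rewrite /= ?subrr mul0r.
Qed.

(** On a face of the cube only the vertices of that face carry weight. *)
Lemma interp_face_ge0 k t i (c : bool) : in_cube t -> t 0 i = c%:R ->
  (forall alpha, alpha i = c -> 0 <= k alpha) -> 0 <= interp k t.
Proof.
move=> ct ti k0; apply: sumr_ge0 => alpha _.
have [/k0 ka|ac] := eqVneq (alpha i) c; first by rewrite mulr_ge0 ?weight_ge0.
rewrite (@weight_eq0 _ _ i) ?mul0r // ti.
by case: (alpha i) c ac {ti k0} => [] [].
Qed.

Lemma continuous_weight alpha : continuous (weight^~ alpha).
Proof.
apply: continuous_big => [|i _ t]; first exact: mul_continuous.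
have ci : {for t, continuous (fun t : 'rV[R]_p => t 0 i)}.
  exact: coord_continuous.
by case: (alpha i) => //; apply: continuousB ci; exact: cst_continuous.
Qed.

Lemma continuous_interp k : continuous (interp k).
Proof.
apply: continuous_big => [|alpha _ t]; first exact: add_continuous.
by apply: continuousM; [exact: continuous_weight | exact: cst_continuous].
Qed.

(** Together with [interp_lin], this also gives closedness of the half-plane conditions comparing
    [(1 - d) mu] with [d nu]. *)
Lemma closed_interp_ge0 k : closed [set t | 0 <= interp k t].
Proof.
apply: (@preimage_closed _ _ (interp k) [set r | 0 <= r]).
  by move=> t _; apply: continuous_interp.
exact: closed_ge.
Qed.

Lemma interp_lin a b k k' t :
  interp (fun alpha => a * k alpha - b * k' alpha) t =
  a * interp k t - b * interp k' t.
Proof.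
rewrite !mulr_sumr -sumrB; apply: eq_bigr => alpha _.
by ring.
Qed.

Lemma vertex_multipliers_combine (S : {set 'I_p})
    (mu nu : vertex -> 'rV[R]_p) d :
    in_cube d ->
    (forall alpha i, i \in S -> alpha i = false -> 0 <= mu alpha 0 i) ->
    (forall alpha i, i \in S -> alpha i = true -> 0 <= nu alpha 0 i) ->
  exists w : vertex -> R,
    [/\ forall alpha, 0 <= w alpha, \sum_alpha w alpha = 1
      & forall i, i \in S ->
        let m := \sum_alpha w alpha * mu alpha 0 i in
        let n := \sum_alpha w alpha * nu alpha 0 i in
        (0 <= m /\ 0 <= n) \/ (1 - d 0 i) * m = d 0 i * n].
Proof.
move=> cd mu0 nu0.
pose m i := interp (fun alpha => mu alpha 0 i).
pose n i := interp (fun alpha => nu alpha 0 i).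
pose s i :=
  interp (fun alpha => (1 - d 0 i) * mu alpha 0 i - d 0 i * nu alpha 0 i).
pose s' i :=
  interp (fun alpha => d 0 i * nu alpha 0 i - (1 - d 0 i) * mu alpha 0 i).
(* Indices outside [S] get the whole space, so they impose no condition on [t]. *)
pose A i :=
  if i \in S then [set t | 0 <= m i t] `|` [set t | 0 <= s i t] else setT.
pose B i :=
  if i \in S then [set t | 0 <= n i t] `|` [set t | 0 <= s' i t] else setT.
have sE i t : s i t = (1 - d 0 i) * m i t - d 0 i * n i t by apply: interp_lin.
have s'E i t : s' i t = - s i t by rewrite sE opprB; apply: interp_lin.
have [i|i|i t ct ti|i t ct ti|i t ct|t ct AB] := @poincare_miranda R p A B.
- rewrite /A; case: ifP => _; last exact: closedT.
  by apply: closedU; apply: closed_interp_ge0.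
- rewrite /B; case: ifP => _; last exact: closedT.
  by apply: closedU; apply: closed_interp_ge0.
- rewrite /A; case: ifPn => // iS; left.
  by apply: (@interp_face_ge0 _ _ i false) => // alpha; apply: mu0.
- rewrite /B; case: ifPn => // iS; left.
  by apply: (@interp_face_ge0 _ _ i true) => // alpha; apply: nu0.
- rewrite /A /B; case: ifPn => // iS; last by left.
  have [s0|s0] := leP 0 (s i t); first by left; right.
  by right; right; rewrite /= s'E; lra.
exists (weight t); split=> [alpha||i iS /=]; first exact: weight_ge0.
  exact: sum_weight.
suff: (0 <= m i t /\ 0 <= n i t) \/ (1 - d 0 i) * m i t = d 0 i * n i t by [].
have := AB i; rewrite /A /B iS /= s'E sE.
have /andP[d0 d1] := cd i.
move: (m i t) (n i t) (d 0 i) d0 d1 => M N e e0 e1 [[M0|sM] [N0|sN]].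
- by left.
(* Here [M >= 0] and [(1 - e) M <= e N]. For [e > 0] this gives [N >= 0]; for [e = 0] it forces
   [M = 0], which is the equation of the line. The next case is symmetric, with [e = 1]
   exceptional. *)
- have [e_eq0|e_neq0] := eqVneq e 0.
    by right; rewrite e_eq0 subr0 mul1r mul0r in sN *; lra.
  have e_gt0 : 0 < e by rewrite lt_def e_neq0.
  left; split=> //; rewrite -(pmulr_rge0 _ e_gt0).
  by have := mulr_ge0 (_ : 0 <= 1 - e) M0; lra.
- have [e_eq1|e_neq1] := eqVneq e 1.
    by right; rewrite e_eq1 subrr mul1r mul0r in sM *; lra.
  have e_lt1 : 0 < 1 - e by rewrite subr_gt0 lt_def eq_sym e_neq1.
  left; split=> //; rewrite -(pmulr_rge0 _ e_lt1).
  by have := mulr_ge0 e0 N0; lra.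
- by right; lra.
Qed.
End Interpolation.

(** * Stationarity *)

Lemma sum_scale_coord (R : realType) q (I : finType) (w : I -> R)
    (v : I -> 'rV[R]_q) i :
  (\sum_k w k *: v k) 0 i = \sum_k w k * v k 0 i.
Proof. by rewrite summxE; apply: eq_bigr => k _; rewrite mxE. Qed.

Section Stationarity.
Variables (R : realType) (n l m p : nat) (P : mpcc R n l m p).
Implicit Types (x : 'rV[R]_n) (alpha : {ffun 'I_p -> bool}).

Lemma lin_B_A_stationary x alpha :
  lin_B_stationary P x -> A_stationary P alpha x.
Proof.
move=> Bx.
pose T := (('I_l + 'I_m) + ('I_p + 'I_p))%type.
(* Constraints absent from the linearized cone are kept in the family as zero vectors, which do not
   affect the cone. *)
pose a (k : T) : 'rV[R]_n := match k with
  | inl (inl i) => if i \in I_g P x then grad_g P i x else 0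
  | inl (inr i) => grad_h P i x
  | inr (inl i) => if i \in I_p0 P x then 0 else - grad_G P i x
  | inr (inr i) => if i \in I_0p P x then 0 else - grad_H P i x end.
(* [free] marks the equations, whose multipliers have no sign. For a biactive index, [alpha] decides
   which of the two derivatives is frozen at zero; the other one stays an inequality, and its
   multiplier gets the sign required by [A_stationary]. *)
pose free (k : T) := match k with
  | inl (inl _) => false
  | inl (inr _) => true
  | inr (inl i) => i \notin I_00eq P alpha false x
  | inr (inr i) => i \notin I_00eq P alpha true x end.
have [y ineq eqs|c c_ge0 cE] :=
    @farkas R n T [set k | free k]%SET a (- grad_f P x).
  have G0 i : i \notin I_00eq P alpha false x -> i \notin I_p0 P x ->
      dot (grad_G P i x) y = 0.
    move=> iG ip0; have := eqs (inr (inl i)); rewrite inE /= (negbTE ip0) iG.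
    by rewrite dotNl => /(_ isT)/eqP; rewrite oppr_eq0 => /eqP.
  have H0 i : i \notin I_00eq P alpha true x -> i \notin I_0p P x ->
      dot (grad_H P i x) y = 0.
    move=> iG ip0; have := eqs (inr (inr i)); rewrite inE /= (negbTE ip0) iG.
    by rewrite dotNl => /(_ isT)/eqP; rewrite oppr_eq0 => /eqP.
  apply: Bx; split=> [i ig|i|i i0p|i ip0|i i00].
  - by have := ineq (inl (inl i)); rewrite inE /= ig; apply.
  - by apply: (eqs (inl (inr i))); rewrite inE.
  - move: i0p; rewrite !inE => /andP[Gi Hi].
    by apply: G0; rewrite !inE (gt_eqF Hi) ?andbF.
  - move: ip0; rewrite !inE => /andP[Gi Hi].
    by apply: H0; rewrite !inE (gt_eqF Gi) ?andbF.
  have : i \in I_00 P x by [].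
  rewrite inE => /andP[/eqP Gi /eqP Hi].
  have ip0 : i \notin I_p0 P x by rewrite inE Gi ltxx.
  have i0p : i \notin I_0p P x by rewrite inE Hi ltxx andbF.
  case ai: (alpha i).
    have Gy0 : dot (grad_G P i x) y = 0.
      by apply: G0 => //; rewrite inE i00 ai.
    rewrite Gy0 mul0r; split=> //; have := ineq (inr (inr i)).
    by rewrite !inE /= inE i00 ai (negbTE i0p) dotNl oppr_le0; apply.
  have Hy0 : dot (grad_H P i x) y = 0.
    by apply: H0 => //; rewrite inE i00 ai.
  rewrite Hy0 mulr0; split=> //; have := ineq (inr (inl i)).
  by rewrite !inE /= inE i00 ai (negbTE ip0) dotNl oppr_le0; apply.
(* The Farkas coefficient of a zero vector is arbitrary; it is reset to 0, as weak stationarity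
   demands at these indices. *)
exists (\row_i if i \in I_g P x then c (inl (inl i)) else 0).
exists (\row_i c (inl (inr i))).
exists (\row_i if i \in I_p0 P x then 0 else c (inr (inl i))).
exists (\row_i if i \in I_0p P x then 0 else c (inr (inr i))).
split=> [|i i00|i i00]; last 2 first.
- rewrite mxE; case: ifP => // _; apply: c_ge0; rewrite inE /= negbK.
  exact: i00.
- rewrite mxE; case: ifP => // _; apply: c_ge0; rewrite inE /= negbK.
  exact: i00.
split=> [|i ig|i ig|i ip|i ip]; last 4 first.
- by rewrite mxE ig; apply: c_ge0; rewrite inE.
- by rewrite mxE (negbTE ig).
- by rewrite mxE ip.
- by rewrite mxE ip.
move/eqP: cE; rewrite eq_sym -subr_eq0 opprK addrC !big_sumType /=.
rewrite !addrA => /eqP E; rewrite -[RHS]E.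
congr (_ + _ + _ + _ + _); rewrite -?sumrN;
  apply: eq_bigr => i _; rewrite mxE //.
- by case: ifP; rewrite ?scale0r ?scaler0.
- by case: ifP; rewrite ?scale0r ?scaler0 ?oppr0 ?scalerN.
- by case: ifP; rewrite ?scale0r ?scaler0 ?oppr0 ?scalerN.
Qed.

Lemma weak_stationarity_convex x (I : finType) (w : I -> R) lam eta mu nu :
    (forall k, 0 <= w k) -> \sum_k w k = 1 ->
    (forall k, weak_stationarity P x (lam k) (eta k) (mu k) (nu k)) ->
  weak_stationarity P x (\sum_k w k *: lam k) (\sum_k w k *: eta k)
    (\sum_k w k *: mu k) (\sum_k w k *: nu k).
Proof.
move=> w0 w1 W.
have comb_grad q (v : I -> 'rV[R]_q) (g : 'I_q -> 'rV[R]_n) :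
    \sum_i (\sum_k w k *: v k) 0 i *: g i = \sum_k w k *: \sum_i v k 0 i *: g i.
  under [RHS]eq_bigr => k _ do rewrite scaler_sumr.
  rewrite [RHS]exchange_big; apply: eq_bigr => i _ /=.
  rewrite sum_scale_coord scaler_suml; apply: eq_bigr => k _.
  by rewrite scalerA.
split=> [|i ig|i ig|i ip|i ip]; last 4 first.
- rewrite sum_scale_coord sumr_ge0 // => k _; have [_ + _ _ _] := W k.
  by move=> /(_ _ ig); apply: mulr_ge0.
- rewrite sum_scale_coord big1 // => k _; have [_ _ + _ _] := W k.
  by move=> /(_ _ ig) ->; rewrite mulr0.
- rewrite sum_scale_coord big1 // => k _; have [_ _ _ + _] := W k.
  by move=> /(_ _ ip) ->; rewrite mulr0.
- rewrite sum_scale_coord big1 // => k _; have [_ _ _ _] := W k.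
  by move=> /(_ _ ip) ->; rewrite mulr0.
(* Writing the coefficient 1 of the objective gradient as the sum of the weights makes the equation
   a weighted sum of the given ones. *)
rewrite !comb_grad -[grad_f P x]scale1r -w1 scaler_suml.
rewrite -!big_split /= -!sumrB; apply: big1 => k _.
have [W0 _ _ _ _] := W k.
by rewrite -!scalerDr -!scalerBr W0 scaler0.
Qed.

(** One family of weights combines all four multipliers: any convex weights preserve weak
    stationarity, and those of [vertex_multipliers_combine] also achieve the alternative on the
    biactive set. *)
Lemma A_Pd_stationary x :
    (forall alpha, A_stationary P alpha x) ->
  forall d : 'rV[R]_p, (forall i, 0 <= d 0 i <= 1) -> Pd_stationary P d x.
Proof.
move=> Ax d cd.
have /choice[M MP] : forall alpha, exists M : 'rV_l * 'rV_m * ('rV_p * 'rV_p),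
    [/\ weak_stationarity P x M.1.1 M.1.2 M.2.1 M.2.2,
      forall i, i \in I_00eq P alpha false x -> 0 <= M.2.1 0 i
    & forall i, i \in I_00eq P alpha true x -> 0 <= M.2.2 0 i].
  move=> alpha; have [lam [eta [mu [nu H]]]] := Ax alpha.
  by exists (lam, eta, (mu, nu)).
have [alpha i iS ai|alpha i iS ai|w [w0 w1 wP]] :=
  @vertex_multipliers_combine R p (I_00 P x) (fun alpha => (M alpha).2.1)
    (fun alpha => (M alpha).2.2) d cd.
- by have [_ + _] := MP alpha; apply; rewrite inE iS ai.
- by have [_ _] := MP alpha; apply; rewrite inE iS ai.
exists (\sum_alpha w alpha *: (M alpha).1.1).
exists (\sum_alpha w alpha *: (M alpha).1.2).
exists (\sum_alpha w alpha *: (M alpha).2.1).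
exists (\sum_alpha w alpha *: (M alpha).2.2).
split; first by apply: weak_stationarity_convex => // alpha; case: (MP alpha).
by move=> i /wP; rewrite !sum_scale_coord.
Qed.

Lemma Pd_Palpha_stationary x :
    (forall d : 'rV[R]_p, (forall i, 0 <= d 0 i <= 1) -> Pd_stationary P d x) ->
  forall alpha, Palpha_stationary P alpha x.
Proof.
move=> Px alpha.
have [i|lam [eta [mu [nu [W S]]]]] := Px (\row_i (alpha i)%:R).
  by rewrite mxE; case: (alpha i); rewrite ler01 lexx.
exists lam, eta, mu, nu; split=> // i; rewrite inE => /andP[/S + /eqP ai];
  rewrite mxE ai => -[|]; [by left| |by left|].
  by rewrite subr0 mul1r mul0r; right.
by rewrite subrr mul1r mul0r; right.
Qed.

Lemma Palpha_lin_B_stationary x : feasible P x ->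
  (forall alpha, Palpha_stationary P alpha x) -> lin_B_stationary P x.
Proof.
move=> [_ _ G0 H0 GH0] Px y [gy hy Gy Hy GHy].
pose alpha := [ffun i => dot (grad_G P i x) y == 0].
have [lam [eta [mu [nu [[W lam0 lam_in mu0 nu0] Sf St]]]]] := Px alpha.
(* A vanishing sum of nonnegative products has vanishing terms, so every index lies in [I_p0],
   [I_0p] or [I_00]. *)
have GHi i : mpcc_G P x 0 i * mpcc_H P x 0 i = 0.
  by have := psumr_eq0P (fun j _ => mulr_ge0 (G0 j) (H0 j)) GH0; apply.
have GH i : 0 <= mu 0 i * dot (grad_G P i x) y + nu 0 i * dot (grad_H P i x) y.
  have [Gi|Gi] := eqVneq (mpcc_G P x 0 i) 0; last first.
    have iG : i \in I_p0 P x.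
      rewrite inE lt_def Gi G0 /=.
      by have /eqP := GHi i; rewrite mulf_eq0 (negbTE Gi).
    by rewrite mu0 // Hy // mul0r mulr0 addr0.
  have [Hi|Hi] := eqVneq (mpcc_H P x 0 i) 0; last first.
    have iH : i \in I_0p P x by rewrite inE Gi eqxx lt_def Hi H0.
    by rewrite nu0 // Gy // mul0r mulr0 addr0.
  have i00 : i \in I_00 P x by rewrite inE Gi Hi eqxx.
  have [Gyi Hyi /eqP] := GHy i i00; rewrite mulf_eq0.
  (* At most one of the two derivatives along [y] is nonzero, and [alpha] selects the alternative in
     which its multiplier is nonnegative or zero. *)
  have [Gy0 _|Gy0 /= /eqP Hy0] := eqVneq (dot (grad_G P i x) y) 0.
    rewrite Gy0 mulr0 add0r.
    have [|[_ nu_ge0]|->] := St i; first by rewrite inE i00 ffunE Gy0 eqxx.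
      exact: mulr_ge0.
    by rewrite mul0r.
  rewrite Hy0 mulr0 addr0.
  have [|[mu_ge0 _]|->] := Sf i; first by rewrite inE i00 ffunE (negbTE Gy0).
    exact: mulr_ge0.
  by rewrite mul0r.
have lamg : \sum_i lam 0 i * dot (grad_g P i x) y <= 0.
  apply: sumr_le0 => i _; have [ig|ig] := boolP (i \in I_g P x).
    by rewrite mulr_ge0_le0 ?lam0 ?gy //.
  by rewrite lam_in ?mul0r.
have etah : \sum_i eta 0 i * dot (grad_h P i x) y = 0.
  by apply: big1 => i _; rewrite hy mulr0.
have GHsum : 0 <= \sum_i mu 0 i * dot (grad_G P i x) y
                 + \sum_i nu 0 i * dot (grad_H P i x) y.
  by rewrite -big_split /=; apply: sumr_ge0 => i _; apply: GH.
(* Pairing the stationarity equation with [y] expresses the derivative of the objective along [y]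
   through the three sums just estimated, so it is nonnegative. *)
have := congr1 (fun v => dot v y) W.
rewrite !(dotDl, dotNl, dot0l, dot_lincombl).
by lra.
Qed.
End Stationarity.

Theorem corollary4p3 (R : realType) (n l m p : nat)
    (f : 'rV[R]_n -> R) (g : 'rV[R]_n -> 'rV[R]_l) (h : 'rV[R]_n -> 'rV[R]_m)
    (G H : 'rV[R]_n -> 'rV[R]_p)
    (f_diff : forall x : 'rV[R]_n, differentiable f x)
    (g_diff : forall x : 'rV[R]_n, differentiable g x)
    (h_diff : forall x : 'rV[R]_n, differentiable h x)
    (G_diff : forall x : 'rV[R]_n, differentiable G x)
    (H_diff : forall x : 'rV[R]_n, differentiable H x)
    (x : 'rV[R]_n) (x_feasible : feasible (MPCC f g h G H) x) :
  [<-> lin_B_stationary (MPCC f g h G H) x;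
       forall alpha : {ffun 'I_p -> bool},
         A_stationary (MPCC f g h G H) alpha x;
       forall d : 'rV[R]_p, (forall i, 0 <= d 0 i <= 1) ->
         Pd_stationary (MPCC f g h G H) d x;
       forall alpha : {ffun 'I_p -> bool},
         Palpha_stationary (MPCC f g h G H) alpha x].
Proof.
tfae=> [Bx alpha|||].
- exact: lin_B_A_stationary.
- exact: A_Pd_stationary.
- exact: Pd_Palpha_stationary.
- exact: Palpha_lin_B_stationary.
Qed.
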